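(* Let $L$ be a non-negative integer, $f$ a positive integer, and for non-negative integers $n_1,\dots,n_f$ put $N_i:=n_i+n_{i+1}+\dots+n_f$ for $i=1,\dots,f$. Then \[ \sum_{m,n,n_1,\dots,n_f\geq 0}\frac{q^{2m^2+6mn+6n^2-2m-3n+3(N_1^2+\dots+N_f^2)}(q^3;q^3)_{2L}(q^3;q^3)_{n_f}(1+q^{3n_f})}{(q;q)_m(q^3;q^3)_n(q^3;q^3)_{L-N_1}(q^3;q^3)_{n_f-2n-m}(q^3;q^3)_{n_1}\cdots(q^3;q^3)_{n_{f-1}}(q^3;q^3)_{2n_f}}=\sum_{j=-L-1}^{L+1}q^{3(f+1)j^2-2j}(1+q^{3j}){2L\brack L-j}_{q^3}. \]
   Context: $(a;p)_n=\prod_{k=0}^{n-1}(1-ap^k)$ for a base $p$ (here $p=q$ or $p=q^3$). By convention $1/(q;q)_n=0$ and $1/(q^3;q^3)_n=0$ for negative integers $n$, so summands with a negative index in a denominator vanish. The $q$-binomial coefficient is ${m+n\brack m}_p=\frac{(p;p)_{m+n}}{(p;p)_m(p;p)_n}$ for $m,n\ge0$ and $0$ otherwise. *)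

(* Defs.v *)
From HB Require Import structures.
From mathcomp Require Import all_boot all_order all_algebra.
From mathcomp Require Import boolp classical_sets functions cardinality fsbigop.

Set Implicit Arguments.
Unset Strict Implicit.
Unset Printing Implicit Defensive.

Import Order.TTheory GRing.Theory Num.Theory.

Local Open Scope classical_set_scope.
Local Open Scope ring_scope.

(* (a; p)_n *)
Definition qpoch (F : fieldType) (a p : F) (n : nat) : F :=
  \prod_(0 <= k < n) (1 - a * p ^+ k).

(* 1 / (p; p)_k, with the convention that it is 0 for k < 0 *)
Definition rqpoch (F : fieldType) (p : F) (k : int) : F :=
  match k with
  | Posz n => (qpoch p p n)^-1
  | Negz _ => 0
  end.

(* The q-binomial coefficient with top entry a and bottom entry b, base p *)
Definition qbinom (F : fieldType) (p : F) (a b : int) : F :=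
  if (0 <= b) && (0 <= a - b) then
    qpoch p p `|a|%N / (qpoch p p `|b|%N * qpoch p p `|a - b|%N)
  else 0.

(* The entries of a tuple numbered from 1 to f: part v i is n_i *)
Definition part (f : nat) (v : f.-tuple nat) (i : nat) : nat := nth 0%N v i.-1.

(* N_i = n_i + n_(i+1) + ... + n_f *)
Definition tailsum (f : nat) (v : f.-tuple nat) (i : nat) : nat :=
  (\sum_(i <= k < f.+1) part v k)%N.

Definition expo (f : nat) (m n : nat) (v : f.-tuple nat) : int :=
  2 * m%:Z ^+ 2 + 6 * m%:Z * n%:Z + 6 * n%:Z ^+ 2 - 2 * m%:Z - 3 * n%:Z
  + 3 * \sum_(1 <= i < f.+1) (tailsum v i)%:Z ^+ 2.

Definition summand (F : fieldType) (q : F) (L f : nat)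
    (m n : nat) (v : f.-tuple nat) : F :=
  let N := tailsum v in
  let nf := part v f in
  q ^ expo m n v
  * qpoch (q ^+ 3) (q ^+ 3) (2 * L) * qpoch (q ^+ 3) (q ^+ 3) nf
  * (1 + q ^+ (3 * nf))
  * rqpoch q m%:Z
  * rqpoch (q ^+ 3) n%:Z
  * rqpoch (q ^+ 3) (L%:Z - (N 1%N)%:Z)
  * rqpoch (q ^+ 3) (nf%:Z - 2 * n%:Z - m%:Z)
  * (\prod_(1 <= i < f) rqpoch (q ^+ 3) (part v i)%:Z)
  * rqpoch (q ^+ 3) (2 * nf)%:Z.

Lemma rqpoch_neq0 (F : fieldType) (p : F) (k : int) :
  rqpoch p k != 0 -> 0 <= k.
Proof. by case: k => // k; rewrite /= eqxx. Qed.

Lemma part_le_tailsum (f : nat) (v : f.-tuple nat) (i : nat) :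
  (0 < i <= f)%N -> (part v i <= tailsum v 1)%N.
Proof.
move=> /andP[i0 iF]; rewrite /tailsum (bigD1_seq i) ?iota_uniq //=.
  exact: leq_addr.
by rewrite mem_index_iota i0.
Qed.

(* The multisum is a finite sum, so that summing it with [\sum_(x \in setT)]
   does not fall back on the default value for infinite supports. *)
Lemma summand_finite_support (F : fieldType) (q : F) (L f : nat) :
  (0 < f)%N ->
  finite_set [set x : nat * nat * f.-tuple nat |
                summand q L x.1.1 x.1.2 x.2 != 0].
Proof.
move=> f0.
pose T : finType := ('I_L.+1 * 'I_L.+1 * f.-tuple 'I_L.+1)%type.
pose h (y : T) : nat * nat * f.-tuple nat :=
  (val y.1.1, val y.1.2, [tuple of [seq val z | z <- y.2]]).
apply: (@sub_finite_set _ _ (h @` [set: T])); last first.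
  by apply: finite_image; apply: finite_finset.
case=> [[m n] v] /=; rewrite /summand !mulf_eq0 !negb_or.
move=> /andP[/andP[/andP[/andP[_ /rqpoch_neq0 h1] /rqpoch_neq0 h2] _] _].
have NL : (tailsum v 1 <= L)%N by move: h1; rewrite subr_ge0 lez_nat.
have nfL : (part v f <= L)%N.
  by apply: leq_trans NL; apply: part_le_tailsum; rewrite f0 leqnn.
have mnf : (m + 2 * n <= part v f)%N.
  by move: h2; rewrite -addrA -opprD subr_ge0 -PoszM -PoszD lez_nat addnC.
have mL : (m < L.+1)%N.
  by rewrite ltnS (leq_trans _ nfL) // (leq_trans _ mnf) // leq_addr.
have nL : (n < L.+1)%N.
  rewrite ltnS (leq_trans _ nfL) // (leq_trans _ mnf) //.
  by rewrite mul2n -addnn addnA leq_addl.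
exists (inord m, inord n, [tuple of [seq inord z | z <- v]]) => //.
rewrite /h /= !inordK //; congr (_, _, _); apply: val_inj => /=.
rewrite -map_comp; apply: map_id_in => z zv /=; rewrite inordK // ltnS.
apply: leq_trans NL; move: (zv); rewrite -index_mem size_tuple => iv.
by rewrite -(nth_index 0%N zv); apply: (@part_le_tailsum _ v (index z v).+1).
Qed.

(* Main.v *)
(** Put p = q^3. By the Bailey lemma (iterated f times, with j fixed) the sum over
    n_1, ..., n_f reduces to the case f = 0:
      (p;p)_M (1 + p^M) sum_{m,n} q^(2m^2+6mn+6n^2-2m-3n)
                                    / ((q;q)_m (p;p)_n (p;p)_(M-2n-m))
        = sum_j q^(3j^2-2j) (1 + p^j) [2M, M-j]_p.
    A variant of the q-Vandermonde sum writes (1 + p^j) [2M, M-j] as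
    (1 + p^M) sum_k p^(k(k+j-1)) [M,k] [M,k+j]; with l = k+j the right-hand side
    becomes 1 + p^M times sum_{k,l} q^(3(k^2-kl+l^2)-k-2l) [M,k] [M,l].
    Expanding [M,k] [M,l] by q-Vandermonde with k = b+c and l = a+c, then
    1 / ((p)_a (p)_b) by the Durfee square identity, leaves a triple sum that is the
    coefficientwise form of (-y;q)_oo = (-y;p)_oo (-qy;p)_oo (-q^2 y;p)_oo. *)

Require Import Defs.
From HB Require Import structures.
From mathcomp Require Import all_boot all_order all_algebra.
From mathcomp Require Import boolp classical_sets functions cardinality fsbigop.
From mathcomp Require Import zify ring.

Import Order.TTheory GRing.Theory Num.Theory.

Local Open Scope classical_set_scope.
Local Open Scope ring_scope.

#[local] Arguments rqpoch : simpl never.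

(** * q-binomial sums and the Bailey lemma *)

Section Base.
Variables (F : fieldType) (p : F).
Hypothesis p1 : forall k : nat, (0 < k)%N -> p ^+ k != 1.

Lemma qpochS n : qpoch p p n.+1 = qpoch p p n * (1 - p ^+ n.+1).
Proof. by rewrite /qpoch big_nat_recr //= exprS. Qed.

Lemma qpoch_neq0 n : qpoch p p n != 0.
Proof.
elim: n => [|n IH]; first by rewrite /qpoch big_nil oner_neq0.
by rewrite qpochS mulf_neq0 // subr_eq0 eq_sym p1.
Qed.

Lemma rqpoch_lt0 (k : int) : k < 0 -> rqpoch p k = 0.
Proof. by case: k. Qed.

(** At k = 0 the factor [1 - p ^ 0] vanishes, in agreement with the convention for negative indices.
    The recurrence thus holds for every integer k, and boundary terms of later sums drop out by
    themselves. *)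
Lemma rqpochM (k : int) : (1 - p ^ k) * rqpoch p k = rqpoch p (k - 1).
Proof.
case: k => [[|n]|n]; last by rewrite mulr0 rqpoch_lt0 // NegzE; lia.
  by rewrite subrr mul0r.
have -> : n.+1%:Z - 1 = n%:Z by lia.
rewrite /rqpoch qpochS -exprnP invfM mulrCA divff ?mulr1 //.
by rewrite subr_eq0 eq_sym p1.
Qed.

Lemma rqpochK (n : nat) : qpoch p p n * rqpoch p n%:Z = 1.
Proof. by rewrite /rqpoch divff // qpoch_neq0. Qed.

Lemma rqpoch0 : rqpoch p 0 = 1.
Proof. by rewrite -[rqpoch p 0]/(qpoch p p 0)^-1 /qpoch big_nil invr1. Qed.

Hypothesis p0 : p != 0.

Lemma exprz_split (a b c : int) : a = b + c -> p ^ a = p ^ b * p ^ c.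
Proof. by move=> ->; rewrite expfzDr. Qed.

(** Durfee rectangle identity, by induction on a: multiplying by [1 - p ^ a.+1] lowers the index of
    [rqpoch p a.+1%:Z], so the sum for a + 1 has to be matched with the one for a. *)
Lemma durfee_sum (a : nat) (b : int) :
  \sum_(0 <= n < a.+1) p ^ ((a%:Z - n%:Z) * (b - n%:Z))
     * (rqpoch p n%:Z * rqpoch p (a%:Z - n%:Z) * rqpoch p (b - n%:Z))
  = rqpoch p a%:Z * rqpoch p b.
Proof.
elim: a => [|a IH].
  by rewrite big_nat1 subrr subr0 mul0r expr0z rqpoch0 !mul1r.
have a1 : 1 - p ^ a.+1%:Z != 0 by rewrite -exprnP subr_eq0 eq_sym p1.
apply: (mulfI a1); rewrite mulrA rqpochM.
have -> : a.+1%:Z - 1 = a%:Z by lia.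
rewrite -{}IH big_distrr /=.
(* The split is 1 - p^(a+1) = (1 - p^(a+1-n)) + p^(a+1-n) (1 - p^n). After n is shifted in the
   second sum, the two terms carry p^(b-n) and 1 - p^(b-n), which add up to 1. *)
rewrite [LHS](_ : _ =
  \sum_(0 <= n < a.+2) p ^ ((a.+1%:Z - n%:Z) * (b - n%:Z))
     * (rqpoch p n%:Z * rqpoch p (a%:Z - n%:Z) * rqpoch p (b - n%:Z)) +
  \sum_(0 <= n < a.+2) p ^ ((a.+1%:Z - n%:Z) * (b - n%:Z) + a.+1%:Z - n%:Z)
     * (rqpoch p (n%:Z - 1) * rqpoch p (a.+1%:Z - n%:Z) * rqpoch p (b - n%:Z)));
  last first.
  rewrite -big_split; apply: eq_bigr => n _ /=.
  have -> : rqpoch p (a%:Z - n%:Z)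
    = (1 - p ^ (a.+1%:Z - n%:Z)) * rqpoch p (a.+1%:Z - n%:Z).
    by rewrite rqpochM; congr (rqpoch p _); lia.
  rewrite -rqpochM (@exprz_split (_ + _ - _) _ _ (esym (addrA _ _ _))).
  have -> : p ^ a.+1%:Z = p ^ (a.+1%:Z - n%:Z) * p ^ n%:Z.
    by rewrite -expfzDr //; congr (p ^ _); lia.
  ring.
rewrite big_nat_recr //= [X in _ + _ + X]big_nat_recl //=.
rewrite (_ : rqpoch p (a%:Z - a.+1%:Z) = 0); last by rewrite rqpoch_lt0 //; lia.
rewrite !(mulr0, mul0r) addr0 add0r -big_split; apply: eq_bigr => n _ /=.
have -> : n.+1%:Z - 1 = n%:Z by lia.
have -> : a.+1%:Z - n.+1%:Z = a%:Z - n%:Z by lia.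
have -> : rqpoch p (b - n.+1%:Z) = (1 - p ^ (b - n%:Z)) * rqpoch p (b - n%:Z).
  by rewrite rqpochM; congr (rqpoch p _); lia.
have -> : (a%:Z - n%:Z) * (b - n.+1%:Z) + a.+1%:Z - n.+1%:Z
  = (a%:Z - n%:Z) * (b - n%:Z) by lia.
have -> : p ^ ((a.+1%:Z - n%:Z) * (b - n%:Z))
  = p ^ ((a%:Z - n%:Z) * (b - n%:Z)) * p ^ (b - n%:Z).
  by rewrite -expfzDr //; congr (p ^ _); lia.
ring.
Qed.

(** Built from [rqpoch] rather than by cases, so that the Pascal rules hold for every integer x. *)
Definition qbin (n : nat) (x : int) : F :=
  qpoch p p n * (rqpoch p x * rqpoch p (n%:Z - x)).

Lemma qbin_lt0 n x : x < 0 -> qbin n x = 0.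
Proof. by move=> x0; rewrite /qbin (rqpoch_lt0 x) // mul0r mulr0. Qed.

Lemma qbin_gt n x : n%:Z < x -> qbin n x = 0.
Proof. by move=> nx; rewrite /qbin (rqpoch_lt0 (_ - _)) ?subr_lt0 ?mulr0. Qed.

Lemma qbin_sym n x : qbin n (n%:Z - x) = qbin n x.
Proof. by rewrite /qbin subKr [rqpoch p x * _]mulrC. Qed.

Lemma qbinS n x : qbin n.+1 x = qbin n (x - 1) + p ^ x * qbin n x.
Proof.
rewrite /qbin qpochS.
have -> : n%:Z - (x - 1) = n.+1%:Z - x by lia.
have -> : rqpoch p (n%:Z - x) = (1 - p ^ (n.+1%:Z - x)) * rqpoch p (n.+1%:Z - x).
  by rewrite rqpochM; congr (rqpoch p _); lia.
rewrite -rqpochM -[p ^+ n.+1]/(p ^ n.+1%:Z).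
have -> : p ^ n.+1%:Z = p ^ (n.+1%:Z - x) * p ^ x.
  by rewrite -expfzDr //; congr (p ^ _); lia.
ring.
Qed.

Lemma qbinSr n x : qbin n.+1 x = qbin n x + p ^ (n.+1%:Z - x) * qbin n (x - 1).
Proof.
rewrite -qbin_sym qbinS addrC [RHS]addrC.
by congr (_ * _ + _); rewrite -qbin_sym; congr qbin; lia.
Qed.

Lemma qbinSK n x :
  (1 - p ^ (n%:Z - x)) * qbin n x = (1 - p ^ (x + 1)) * qbin n (x + 1).
Proof.
rewrite /qbin.
have := rqpochM (x + 1); rewrite addrK => <-.
have -> : n%:Z - (x + 1) = n%:Z - x - 1 by lia.
rewrite -(rqpochM (n%:Z - x)); ring.
Qed.

(** Induction on m for all j at once: one Pascal rule on [qbin m.+1 k] gives the sums at j and,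
    after a shift of k, at j + 1; the other Pascal rule splits the right-hand side in the same
    way. *)
Lemma qbin_vandermonde m n (j : int) :
  \sum_(0 <= k < m.+1) p ^ (k%:Z * (k%:Z + j)) * (qbin m k * qbin n (k%:Z + j))
  = qbin (m + n) (m%:Z + j).
Proof.
elim: m j => [|m IH] j.
  rewrite big_nat1 mul0r expr0z mul1r add0r add0n /(qbin 0) subrr rqpoch0.
  by rewrite /qpoch big_nil !mul1r.
rewrite addSn qbinS.
have -> : m.+1%:Z + j - 1 = m%:Z + j by lia.
have -> : m.+1%:Z + j = m%:Z + (j + 1) by lia.
rewrite -!IH.
rewrite [LHS](_ : _ =
  \sum_(0 <= k < m.+2) p ^ (k%:Z * (k%:Z + j)) * (qbin m k * qbin n (k%:Z + j)) +
  \sum_(0 <= k < m.+2) p ^ (k%:Z * (k%:Z + j)) * p ^ (m.+1%:Z - k%:Z) *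
     (qbin m (k%:Z - 1) * qbin n (k%:Z + j))); last first.
  by rewrite -big_split; apply: eq_bigr => k _ /=; rewrite qbinSr; ring.
rewrite big_nat_recr //= [X in _ + _ + X]big_nat_recl //=.
rewrite (qbin_gt _ m.+1%:Z) ?(qbin_lt0 _ (0 - 1)) //; last by lia.
rewrite !(mulr0, mul0r) addr0 add0r; congr (_ + _).
rewrite big_distrr; apply: eq_bigr => k _ /=.
rewrite mulrA -!expfzDr //.
by congr (p ^ _ * (qbin m _ * qbin n _)); lia.
Qed.

(** Both sides satisfy the same first-order recurrence in j and vanish for j > M. *)
Lemma sum_qbin_shift M (j : int) :
  (1 + p ^+ M) *
  \sum_(0 <= k < M.+1) p ^ (k%:Z * (k%:Z + j - 1)) * (qbin M k * qbin M (k%:Z + j))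
  = (1 + p ^ j) * qbin (M + M) (M%:Z + j).
Proof.
pose V j := \sum_(0 <= k < M.+1)
   p ^ (k%:Z * (k%:Z + j - 1)) * (qbin M k * qbin M (k%:Z + j)).
have Vbig i : M%:Z < i -> V i = 0.
  by move=> Mi; rewrite /V big1 // => k _; rewrite (qbin_gt M (_ + _)) ?mulr0 //; lia.
(* Split off 1 - p^k and shift k; then descend on i from i > M, where V i = 0. *)
have VS i : V i = qbin (M + M) (M%:Z + i) + p ^ i * qbin (M + M) (M%:Z + (i + 1))
   - p ^ (i + M%:Z) * V (i + 1).
  suff H : V i - qbin (M + M) (M%:Z + i) =
      p ^ i * qbin (M + M) (M%:Z + (i + 1)) - p ^ (i + M%:Z) * V (i + 1).
    by rewrite -addrA -H addrC subrK.
  rewrite -!qbin_vandermonde /V -sumrB.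
  rewrite [LHS](_ : _ = \sum_(0 <= k < M.+1) p ^ (k%:Z * (k%:Z + i - 1)) *
      ((1 - p ^ k%:Z) * qbin M k * qbin M (k%:Z + i))); last first.
    apply: eq_bigr => k _; rewrite -[p ^ k%:Z in RHS]mulr1.
    have -> : k%:Z * (k%:Z + i) = k%:Z * (k%:Z + i - 1) + k%:Z by ring.
    rewrite expfzDr //; ring.
  rewrite big_nat_recl //= expr0z subrr !(mul0r, mulr0) add0r.
  rewrite !big_distrr -sumrB /= [RHS]big_nat_recr //=.
  rewrite (_ : _ - _ = 0); last first.
    have E : p ^ i * p ^ (M%:Z * (M%:Z + (i + 1)))
        = p ^ (i + M%:Z) * p ^ (M%:Z * (M%:Z + (i + 1) - 1)).
      by rewrite -!expfzDr //; congr (p ^ _); ring.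
    by rewrite mulrA E -mulrA subrr.
  rewrite addr0; apply: eq_bigr => k _.
  have -> : qbin M k.+1%:Z = qbin M (k%:Z + 1) by congr qbin; lia.
  have -> : p ^ k.+1%:Z = p ^ (k%:Z + 1) by congr (p ^ _); lia.
  rewrite -qbinSK.
  have -> : k.+1%:Z + i = k%:Z + (i + 1) by lia.
  have -> : k.+1%:Z * (k%:Z + (i + 1) - 1) = k%:Z * (k%:Z + i) + k%:Z + i by lia.
  have -> : k%:Z * (k%:Z + (i + 1)) = k%:Z * (k%:Z + i) + k%:Z by lia.
  have -> : k%:Z * (k%:Z + (i + 1) - 1) = k%:Z * (k%:Z + i) by lia.
  have E : p ^ M%:Z = p ^ (M%:Z - k%:Z) * p ^ k%:Z.
    by rewrite -expfzDr //; congr (p ^ _); lia.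
  rewrite (exprz_split (i + M%:Z) _ _ erefl) E.
  move: (p ^ (M%:Z - k%:Z)) => t.
  rewrite !expfzDr //; ring.
change ((1 + p ^+ M) * V j = (1 + p ^ j) * qbin (M + M) (M%:Z + j)).
have [Mj|jM] := ltP M%:Z j.
  by rewrite Vbig // qbin_gt ?mulr0 //; lia.
have [d ->] : exists d : nat, j = M%:Z - d%:Z by exists `|M%:Z - j|%N; lia.
elim: d {j jM} => [|d IH].
  rewrite VS Vbig; last by lia.
  rewrite (qbin_gt _ (M%:Z + (_ + 1))); last by lia.
  by rewrite !mulr0 subr0 addr0 subr0.
rewrite VS.
have -> : M%:Z - d.+1%:Z + 1 = M%:Z - d%:Z by lia.
rewrite mulrBr [X in _ - X]mulrCA IH.
set i := M%:Z - d.+1%:Z.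
have -> : M%:Z - d%:Z = i + 1 by rewrite /i; lia.
have := qbinSK (M + M) (M%:Z + i).
have -> : (M + M)%:Z - (M%:Z + i) = M%:Z - i by lia.
have -> : M%:Z + i + 1 = M%:Z + (i + 1) by lia.
have E : p ^+ M = p ^ i * p ^ (M%:Z - i).
  by rewrite -expfzDr // exprnP; congr (p ^ _); lia.
have -> : p ^ (M%:Z + (i + 1)) = p ^+ M * (p ^ i * p).
  by rewrite !expfzDr // expr1z.
have -> : p ^ (i + M%:Z) = p ^ i * p ^+ M by rewrite expfzDr.
have -> : p ^ (i + 1) = p ^ i * p by rewrite expfzDr // expr1z.
move: (p ^ i) (p ^ (M%:Z - i)) (qbin _ _) (qbin _ _) E => u t B A -> H.
(* The two sides differ by [p ^ i] times the relation [H], which is an instance of [qbinSK]. *)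
apply: subr0_eq; transitivity (u * ((1 - u * t * (u * p)) * B - (1 - t) * A)).
  ring.
by rewrite H subrr mulr0.
Qed.

(** By symmetry j >= 0 may be assumed; then this is [durfee_sum] with a = L - j and b = L + j,
    summed backwards via r = L - n, since (r - j)(r + j) = r^2 - j^2. *)
Lemma bailey_lemma (L : nat) (j : int) :
  \sum_(0 <= r < L.+1) p ^ (r%:Z ^+ 2)
     * (rqpoch p (L%:Z - r%:Z) * rqpoch p (r%:Z - j) * rqpoch p (r%:Z + j))
  = p ^ (j ^+ 2) * (rqpoch p (L%:Z - j) * rqpoch p (L%:Z + j)).
Proof.
wlog: j / exists i : nat, j = i%:Z; last case=> i ->.
  move=> H; case: (leP 0 j) => j0; first by apply: H; exists `|j|%N; lia.
  have /H E : exists i : nat, - j = i%:Z; first by exists `|j|%N; lia.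
  rewrite sqrrN opprK [rqpoch p (L%:Z + j) * _]mulrC in E.
  rewrite -{}E; apply: eq_bigr => r _; ring.
have [iL|Li] := leqP i L; last first.
  rewrite (rqpoch_lt0 (L%:Z - _)) ?mul0r ?mulr0; last by lia.
  rewrite big_nat big1 // => r /andP[_ rL].
  by rewrite (rqpoch_lt0 (r%:Z - _)) ?(mulr0, mul0r) ?mulr0 //; lia.
have -> : L%:Z - i%:Z = (L - i)%N%:Z by lia.
rewrite -durfee_sum big_distrr /= (big_cat_nat (n := i)) //=; last by lia.
rewrite big_nat big1 ?add0r; last first.
  move=> r /andP[_ rL].
  by rewrite (rqpoch_lt0 (r%:Z - _)) ?(mulr0, mul0r) ?mulr0 //; lia.
rewrite -{1}[i]add0n big_addn subSn // [RHS]big_nat_rev /=.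
rewrite !big_nat; apply: eq_bigr => r /andP[_ rL].
rewrite mulrA -expfzDr // add0n.
have -> : ((L - i).+1 - r.+1)%N%:Z = L%:Z - i%:Z - r%:Z by lia.
have -> : (L - i)%N%:Z = L%:Z - i%:Z by lia.
rewrite PoszD.
congr (p ^ _ * (rqpoch p _ * rqpoch p _ * rqpoch p _)); ring.
Qed.

End Base.

Arguments qbin {F} p n x.

(** The terms with a < n vanish by the convention on negative indices, and the hypothesis on G lets
    the upper bound N survive the substitution of a + n for a. *)
Lemma sum_rqpoch_shift (F : fieldType) (p : F) (N n : nat) (G : nat -> F) :
  (forall s, (N <= s)%N -> G s = 0) ->
  \sum_(0 <= a < N) rqpoch p (a%:Z - n%:Z) * G a
  = \sum_(0 <= a < N) rqpoch p a%:Z * G (a + n)%N.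
Proof.
move=> G0; have [nN|Nn] := leqP n N; last first.
  rewrite [RHS]big1 => [|a _]; last by rewrite G0 ?mulr0 //; lia.
  rewrite big_nat big1 // => a /andP[_ aN].
  by rewrite rqpoch_lt0 ?mul0r //; lia.
rewrite (big_cat_nat (n := n)) //= big_nat big1 ?add0r; last first.
  by move=> a /andP[_ an]; rewrite rqpoch_lt0 ?mul0r //; lia.
rewrite -{1}[n]add0n big_addn [RHS](big_cat_nat (n := (N - n)%N)) ?leq_subr //=.
rewrite [X in _ = _ + X]big_nat [X in _ = _ + X]big1 ?addr0; last first.
  by move=> a /andP[aN _]; rewrite G0 ?mulr0 //; lia.
by apply: eq_bigr => a _; congr (rqpoch p _ * _); lia.
Qed.

(** * The case f = 0 *)

Section CubicBase.
Variables (F : fieldType) (q : F).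
Hypothesis q0 : q != 0.
Hypothesis q1 : forall k : nat, (0 < k)%N -> q ^+ k != 1.

Let p := q ^+ 3.
Let p0 : p != 0. Proof. exact: expf_neq0. Qed.
Let p1 k : (0 < k)%N -> p ^+ k != 1.
Proof. by move=> k0; rewrite /p -exprM q1 // muln_gt0. Qed.

Lemma expr3z (x : int) : p ^ x = q ^ (3 * x).
Proof. by rewrite /p exprnP exprz_exp. Qed.

(* Equal to 3 (C(a,2) + C(b,2) + C(c,2)) + a + 2b + 3 C(a+b+c,2): the exponent of the
   coefficient of y^(a+b+c) in the triple product, rescaled by p^C(a+b+c,2) so that
   it is an integral quadratic form. *)
Definition tri_expo (a b c : int) : int :=
  3 * (a ^+ 2 + b ^+ 2 + c ^+ 2 + a * b + a * c + b * c) - 2 * a - b - 3 * c.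

(** A finite substitute for power series in y: [w s] is the value assigned to y^s, and a delta
    weight extracts one coefficient of the triple product. *)
Definition tri_sum (N : nat) (w : nat -> F) : F :=
  \sum_(0 <= a < N) \sum_(0 <= b < N) \sum_(0 <= c < N) w (a + b + c)%N *
    (q ^ tri_expo a%:Z b%:Z c%:Z
       * (rqpoch p a%:Z * rqpoch p b%:Z * rqpoch p c%:Z)).

(* The functional equation e(y) = (1 + y) e(p y) for e(y) = (-y;p)_oo: replacing y by
   q y permutes the three factors cyclically. *)
Lemma tri_sum_step N (w : nat -> F) :
  (forall s, (N <= s)%N -> w s = 0) ->
  tri_sum N w = tri_sum N (fun s => q ^+ s * w s)
              + tri_sum N (fun s => q ^+ (4 * s) * w s.+1).
Proof.
move=> w0.
have rot (W : nat -> F) : tri_sum N W =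
    \sum_(0 <= a < N) \sum_(0 <= b < N) \sum_(0 <= c < N) W (a + b + c)%N *
    (q ^ tri_expo b%:Z c%:Z a%:Z
       * (rqpoch p a%:Z * rqpoch p b%:Z * rqpoch p c%:Z)).
  rewrite /tri_sum exchange_big /=; under eq_bigr do rewrite exchange_big /=.
  rewrite exchange_big /=.
  apply: eq_bigr => a _; rewrite exchange_big /=; apply: eq_bigr => b _.
  apply: eq_bigr => c _; congr (W _ * (_ * _)); [lia | ring].
rewrite [X in _ = X + _]rot [X in _ = _ + X]rot {rot} /tri_sum.
rewrite -big_split; apply: eq_bigr => a _ /=.
rewrite -big_split; apply: eq_bigr => b _ /=.
have [->|N0] := posnP N; first by rewrite !big_geq // addr0.
rewrite -(prednK N0) in w0 *; move: N.-1 w0 => {N0}N w0.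
rewrite [X in _ = _ + X]big_nat_recr //= w0 ?mulr0 ?mul0r ?addr0; last by lia.
(* Here 1 = p^c + (1 - p^c), and 1 - p^c lowers the index of [rqpoch p c%:Z]. With s = a + b + c,
   the exponents become s and, after c is shifted, 4s plus the rotated [tri_expo b c a]. *)
rewrite [LHS](_ : _ = \sum_(0 <= c < N.+1) w (a + b + c)%N *
    (q ^ (tri_expo a%:Z b%:Z c%:Z + 3 * c%:Z)
       * (rqpoch p a%:Z * rqpoch p b%:Z * rqpoch p c%:Z)) +
  \sum_(0 <= c < N.+1) w (a + b + c)%N *
    (q ^ tri_expo a%:Z b%:Z c%:Z
       * (rqpoch p a%:Z * rqpoch p b%:Z * rqpoch p (c%:Z - 1)))); last first.
  rewrite -big_split; apply: eq_bigr => c _ /=.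
  rewrite -(rqpochM _ _ p1) expfzDr // -expr3z; ring.
rewrite [X in _ + X = _]big_nat_recl //= !mulr0 add0r.
congr (_ + _); apply: eq_bigr => c _.
  rewrite exprnP [_ * w _]mulrC -[RHS]mulrA [in RHS](mulrA (q ^ _)) -expfzDr //.
  by congr (_ * (q ^ _ * _)); rewrite /tri_expo !PoszD; ring.
rewrite exprnP [_ * w _]mulrC -[RHS]mulrA [in RHS](mulrA (q ^ _)) -expfzDr //.
have -> : c.+1%:Z - 1 = c%:Z by lia.
rewrite addnS; congr (_ * (q ^ _ * _)); rewrite /tri_expo PoszM !PoszD intS; ring.
Qed.

(** The coefficient q^C(m,2) / (q;q)_m of y^m in (-y;q)_oo, rescaled by p^C(m,2) like [tri_expo]. *)
Definition tri_total (m : nat) : F :=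
  q ^ (2 * m%:Z ^+ 2 - 2 * m%:Z) * rqpoch q m%:Z.

(** For delta weights [tri_sum_step] becomes (1 - q^(m+1)) e_(m+1) = q^(4m) e_m, a recurrence that
    [tri_total] satisfies as well. *)
Lemma tri_sum_delta N m : (m < N)%N ->
  tri_sum N (fun s => (s == m)%:R) = tri_total m.
Proof.
elim: m => [|m IH] mN.
  rewrite /tri_sum /tri_total; case: N mN => // N _.
  rewrite big_nat_recl //= [X in _ + X]big1 ?addr0; last first.
    by move=> a _; rewrite !big1 // => b _; rewrite big1 // => c _; rewrite mul0r.
  rewrite big_nat_recl //= [X in _ + X]big1 ?addr0; last first.
    by move=> b _; rewrite big1 // => c _; rewrite mul0r.
  rewrite big_nat_recl //= [X in _ + X]big1 ?addr0; last first.
    by move=> c _; rewrite mul0r.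
  by rewrite !rqpoch0 !mulr1.
have m1 : 1 - q ^ m.+1%:Z != 0 by rewrite -exprnP subr_eq0 eq_sym q1.
have linear (g : nat -> F) (k : nat) :
    tri_sum N (fun s => g s * (s == k)%:R) = g k * tri_sum N (fun s => (s == k)%:R).
  rewrite /tri_sum big_distrr; apply: eq_bigr => a _; rewrite big_distrr.
  apply: eq_bigr => b _; rewrite big_distrr; apply: eq_bigr => c _ /=.
  by case: eqP => [->|]; rewrite ?(mulr0, mul0r) // mulr1 mul1r.
have : tri_sum N (fun s => (s == m.+1)%:R) =
    q ^ m.+1%:Z * tri_sum N (fun s => (s == m.+1)%:R) + q ^ (4 * m%:Z) * tri_total m.
  rewrite {1}tri_sum_step; last by move=> s Ns; case: eqP => // sm; lia.
  rewrite (linear (fun s => q ^+ s)) -IH; last by lia.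
  by rewrite -(linear (fun s => q ^ (4 * s%:Z))).
move=> E; apply: (mulfI m1); rewrite mulrBl mul1r {1}E addrAC subrr add0r.
rewrite /tri_total [RHS]mulrCA (rqpochM _ _ q1) mulrA -expfzDr //.
by congr (q ^ _ * rqpoch q _); rewrite intS; ring.
Qed.

(** By linearity, after decomposing w into delta weights. *)
Lemma tri_sumE N (w : nat -> F) :
  (forall s, (N <= s)%N -> w s = 0) ->
  tri_sum N w = \sum_(0 <= m < N) w m * tri_total m.
Proof.
move=> w0; rewrite [RHS]big_nat.
under eq_bigr => m /andP[_ mN] do rewrite -(tri_sum_delta _ _ mN).
rewrite -big_nat /tri_sum; under [RHS]eq_bigr do rewrite big_distrr /=.
rewrite [RHS]exchange_big /=; apply: eq_bigr => a _.
under [RHS]eq_bigr do rewrite big_distrr /=.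
rewrite [RHS]exchange_big /=; apply: eq_bigr => b _.
under [RHS]eq_bigr do rewrite big_distrr /=.
rewrite [RHS]exchange_big /=; apply: eq_bigr => c _.
under [RHS]eq_bigr do rewrite mulrA.
rewrite -mulr_suml; congr (_ * _).
have [sN|Ns] := ltnP (a + b + c) N.
  rewrite (bigD1_seq (a + b + c)%N) ?iota_uniq ?mem_index_iota //= eqxx mulr1.
  by rewrite big1 ?addr0 // => m /negbTE; rewrite eq_sym => ->; rewrite mulr0.
rewrite w0 // big_nat big1 // => m /andP[_ mN].
by case: eqP => [E|_]; rewrite ?mulr0 //; lia.
Qed.

(** The term -3ab is what the Durfee identity for 1 / ((p;p)_a (p;p)_b) absorbs. It introduces n,
    and the remaining triple sum collapses to a sum over m = a + b + c. *)
Lemma tri_sum_fold N (w : nat -> F) :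
  (forall s, (N <= s)%N -> w s = 0) ->
  \sum_(0 <= b < N) \sum_(0 <= c < N) \sum_(0 <= a < N) w (a + b + c)%N *
    (q ^ (tri_expo a%:Z b%:Z c%:Z - 3 * a%:Z * b%:Z)
       * (rqpoch p a%:Z * rqpoch p b%:Z * rqpoch p c%:Z))
  = \sum_(0 <= n < N) \sum_(0 <= m < N) w (m + 2 * n)%N *
    (q ^ (2 * m%:Z ^+ 2 + 6 * m%:Z * n%:Z + 6 * n%:Z ^+ 2 - 2 * m%:Z - 3 * n%:Z)
       * (rqpoch q m%:Z * rqpoch p n%:Z)).
Proof.
move=> w0.
have durfeeN a b : (a < N)%N ->
    rqpoch p a%:Z * rqpoch p b%:Z = \sum_(0 <= n < N)
      p ^ ((a%:Z - n%:Z) * (b%:Z - n%:Z)) *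
        (rqpoch p n%:Z * rqpoch p (a%:Z - n%:Z) * rqpoch p (b%:Z - n%:Z)).
  move=> aN; rewrite -(durfee_sum _ _ p1 p0) [RHS](big_cat_nat (n := a.+1)) //=.
  rewrite [X in _ = _ + X]big_nat [X in _ = _ + X]big1 ?addr0 // => n /andP[an _].
  by rewrite (rqpoch_lt0 _ _ (a%:Z - _)) ?(mulr0, mul0r) ?mulr0 //; lia.
transitivity (\sum_(0 <= n < N) \sum_(0 <= c < N) \sum_(0 <= b < N)
    rqpoch p (b%:Z - n%:Z) * \sum_(0 <= a < N) rqpoch p (a%:Z - n%:Z) *
    (w (a + b + c)%N * (q ^ (tri_expo a%:Z b%:Z c%:Z - 3 * a%:Z * b%:Z
         + 3 * (a%:Z - n%:Z) * (b%:Z - n%:Z))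
       * (rqpoch p n%:Z * rqpoch p c%:Z)))).
  rewrite exchange_big /= [RHS]exchange_big; apply: eq_bigr => c _ /=.
  rewrite [RHS]exchange_big; apply: eq_bigr => b _ /=.
  under [RHS]eq_bigr do rewrite big_distrr /=.
  rewrite [RHS]exchange_big /= !big_nat; apply: eq_bigr => a /andP[_ aN] /=.
  rewrite durfeeN // big_distrl !big_distrr; apply: eq_bigr => n _ /=.
  rewrite [q ^ (_ + 3 * _ * _)]expfzDr // expr3z mulrA; ring.
apply: eq_bigr => n _.
(* Replacing a, b by a + n, b + n adds 6n(a+b+c) + 6n^2 - 3n to the exponent. This depends on a, b,
   c only through their sum, so it can be moved into the weight. *)
transitivity (tri_sum N (fun s => w (s + 2 * n)%N *
    (q ^ (6 * n%:Z * s%:Z + 6 * n%:Z ^+ 2 - 3 * n%:Z) * rqpoch p n%:Z))).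
  rewrite [RHS]/tri_sum [RHS]exchange_big /=.
  under [RHS]eq_bigr do rewrite exchange_big /=.
  rewrite [RHS]exchange_big /=; apply: eq_bigr => c _.
  rewrite sum_rqpoch_shift; last first.
    by move=> b bN; rewrite big1 // => a _; rewrite w0 ?(mulr0, mul0r) //; lia.
  apply: eq_bigr => b _; rewrite sum_rqpoch_shift; last first.
    by move=> a aN; rewrite w0 ?(mulr0, mul0r) //; lia.
  rewrite big_distrr; apply: eq_bigr => a _ /=.
  have -> : (a + n + (b + n) + c = a + b + c + 2 * n)%N by lia.
  rewrite (_ : _ + 3 * _ * _ = (6 * n%:Z * (a + b + c)%N%:Z + 6 * n%:Z ^+ 2 - 3 * n%:Z)
    + tri_expo a%:Z b%:Z c%:Z); last by rewrite /tri_expo !PoszD; ring.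
  rewrite [q ^ (_ + tri_expo _ _ _)]expfzDr //; ring.
rewrite tri_sumE; last by move=> s sN; rewrite w0 ?mul0r //; lia.
apply: eq_bigr => m _; rewrite /tri_total.
rewrite (_ : 2 * _ + _ + _ - _ - _ = (6 * n%:Z * m%:Z + 6 * n%:Z ^+ 2 - 3 * n%:Z)
   + (2 * m%:Z ^+ 2 - 2 * m%:Z)); last by ring.
rewrite [q ^ (_ + (_ - _))]expfzDr //; ring.
Qed.

(** The case f = 0 without the common factor [1 + p ^+ M]. With k = b + c and l = a + c, the left
    exponent plus 3ab equals [tri_expo a b c] - 3ab, the form that [tri_sum_fold] handles. *)
Lemma sum_qbin_qbin M :
  \sum_(0 <= k < M.+1) \sum_(0 <= l < M.+1)
    q ^ (3 * (k%:Z ^+ 2 - k%:Z * l%:Z + l%:Z ^+ 2) - k%:Z - 2 * l%:Z)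
    * (qbin p M k%:Z * qbin p M l%:Z)
  = qpoch p p M * \sum_(0 <= n < M.+1) \sum_(0 <= m < M.+1)
    q ^ (2 * m%:Z ^+ 2 + 6 * m%:Z * n%:Z + 6 * n%:Z ^+ 2 - 2 * m%:Z - 3 * n%:Z)
       * (rqpoch q m%:Z * rqpoch p n%:Z * rqpoch p (M%:Z - 2 * n%:Z - m%:Z)).
Proof.
transitivity (qpoch p p M * \sum_(0 <= b < M.+1) \sum_(0 <= c < M.+1)
   \sum_(0 <= a < M.+1) rqpoch p (M%:Z - (a + b + c)%N%:Z) *
    (q ^ (tri_expo a%:Z b%:Z c%:Z - 3 * a%:Z * b%:Z)
       * (rqpoch p a%:Z * rqpoch p b%:Z * rqpoch p c%:Z))); last first.
  rewrite (tri_sum_fold _ (fun s => rqpoch p (M%:Z - s%:Z))); last first.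
    by move=> s Ms; rewrite rqpoch_lt0 //; lia.
  congr (_ * _); apply: eq_bigr => n _; apply: eq_bigr => m _.
  rewrite mulrC -!mulrA; congr (_ * (_ * (_ * rqpoch p _))).
  rewrite PoszD PoszM; ring.
(* Vandermonde for M = k + (M - k) expands the second binomial; its numerators (p;p)_k and
   (p;p)_(M-k) cancel the denominators of the first. *)
have expand k l : (k < M.+1)%N -> qbin p M k%:Z * qbin p M l%:Z =
    \sum_(0 <= b < M.+1) p ^ (b%:Z * (b%:Z + l%:Z - k%:Z)) * (qpoch p p M *
      (rqpoch p b%:Z * rqpoch p (k%:Z - b%:Z) * rqpoch p (b%:Z + l%:Z - k%:Z)
       * rqpoch p (M%:Z - l%:Z - b%:Z))).
  move=> kM; have -> : qbin p M l%:Z = qbin p (k + (M - k)) (k%:Z + (l%:Z - k%:Z)).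
    by congr qbin; lia.
  rewrite -(qbin_vandermonde _ _ p1 p0) big_distrr [RHS](big_cat_nat (n := k.+1)) //=.
  rewrite [X in _ = _ + X]big_nat [X in _ = _ + X]big1 ?addr0; last first.
    move=> b /andP[kb _].
    by rewrite (rqpoch_lt0 _ _ (k%:Z - _)) ?(mulr0, mul0r) ?mulr0 //; lia.
  apply: eq_bigr => b _; rewrite /qbin addrA.
  have -> : (M - k)%N%:Z - (b%:Z + l%:Z - k%:Z) = M%:Z - l%:Z - b%:Z by lia.
  have -> : M%:Z - k%:Z = (M - k)%N%:Z by lia.
  have P1 := rqpochK _ _ p1 k; have P2 := rqpochK _ _ p1 (M - k).
  transitivity (qpoch p p k * rqpoch p k%:Z *
      (qpoch p p (M - k) * rqpoch p (M - k)%N%:Z) *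
      (p ^ (b%:Z * (b%:Z + l%:Z - k%:Z)) * (qpoch p p M *
      (rqpoch p b%:Z * rqpoch p (k%:Z - b%:Z) * rqpoch p (b%:Z + l%:Z - k%:Z)
       * rqpoch p (M%:Z - l%:Z - b%:Z))))); first by ring.
  by rewrite P1 P2 !mul1r.
transitivity (qpoch p p M * \sum_(0 <= b < M.+1) \sum_(0 <= k < M.+1)
  rqpoch p (k%:Z - b%:Z) * \sum_(0 <= l < M.+1) rqpoch p (b%:Z + l%:Z - k%:Z) *
   (q ^ (3 * (k%:Z ^+ 2 - k%:Z * l%:Z + l%:Z ^+ 2) - k%:Z - 2 * l%:Z
         + 3 * (b%:Z * (b%:Z + l%:Z - k%:Z))) *
    (rqpoch p b%:Z * rqpoch p (M%:Z - l%:Z - b%:Z)))).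
  rewrite [in RHS]exchange_big big_distrr !big_nat; apply: eq_bigr => k /andP[_ kM].
  rewrite /=; under [LHS]eq_bigr do rewrite expand // big_distrr /=.
  rewrite [LHS]exchange_big big_distrr; apply: eq_bigr => b _ /=.
  rewrite !big_distrr; apply: eq_bigr => l _ /=.
  rewrite [q ^ (_ + 3 * (_ * _))]expfzDr // expr3z; ring.
congr (_ * _); apply: eq_bigr => b _.
rewrite sum_rqpoch_shift; last first.
  (* For k > M, either b + l < k or b + l > M, and one of the factors vanishes. *)
  move=> k kM; rewrite big1 // => l _; have [kl|kl] := ltP (b%:Z + l%:Z) k%:Z.
    by rewrite (rqpoch_lt0 _ _ (_ - k%:Z)) ?mul0r //; lia.
  by rewrite (rqpoch_lt0 _ _ (_ - b%:Z)) ?mulr0 //; lia.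
apply: eq_bigr => c _.
under eq_bigr => l _.
  rewrite (_ : b%:Z + l%:Z - (c + b)%N%:Z = l%:Z - c%:Z); last by lia.
  over.
rewrite sum_rqpoch_shift; last first.
  by move=> l lM; rewrite (rqpoch_lt0 _ _ (_ - b%:Z)) ?mulr0 //; lia.
rewrite big_distrr; apply: eq_bigr => a _ /=.
have -> : M%:Z - (a + c)%N%:Z - b%:Z = M%:Z - (a + b + c)%N%:Z by lia.
rewrite (_ : _ + 3 * _ = tri_expo a%:Z b%:Z c%:Z - 3 * a%:Z * b%:Z); last first.
  by rewrite /tri_expo !PoszD; ring.
ring.
Qed.

End CubicBase.

(** * Reindexing of finite sums *)

Lemma big_tupleS (R : Type) (idx : R) (op : Monoid.com_law idx) (T : finType)
    (n : nat) (G : n.+1.-tuple T -> R) :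
  \big[op/idx]_(v : n.+1.-tuple T) G v
  = \big[op/idx]_(x : T) \big[op/idx]_(v : n.-tuple T) G (cons_tuple x v).
Proof.
rewrite pair_big /= (reindex (fun xv : T * n.-tuple T => cons_tuple xv.1 xv.2)) //=.
exists (fun v : n.+1.-tuple T => (thead v, [tuple of behead v])).
  by move=> [x v] _ /=; congr (_, _); apply: val_inj.
by move=> v _; rewrite [v in RHS]tuple_eta; apply: val_inj.
Qed.

Lemma sum_int_shift (V : nmodType) (G : int -> V) (M n c : nat) :
  (forall x, (x < 0) || (M%:Z < x) -> G x = 0) -> (c + M < n)%N ->
  \sum_(0 <= i < n) G (i%:Z - c%:Z) = \sum_(0 <= l < M.+1) G l%:Z.
Proof.
move=> G0 cMn; rewrite (big_cat_nat (n := c)) //=; last by lia.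
rewrite big_nat big1 ?add0r; last first.
  by move=> i /andP[_ ic]; rewrite G0 //; apply/orP; left; lia.
rewrite -{1}[c]add0n big_addn (big_cat_nat (n := M.+1)) //=; last by lia.
rewrite [X in _ + X]big_nat [X in _ + X]big1 ?addr0; last first.
  by move=> i /andP[iM _]; rewrite G0 //; apply/orP; right; lia.
by apply: eq_bigr => i _; congr G; lia.
Qed.

(** * Bailey chains *)

Section BaileyChain.
Variables (F : fieldType) (p : F).
Hypothesis p1 : forall k : nat, (0 < k)%N -> p ^+ k != 1.
Hypothesis p0 : p != 0.

(* For s = n_1, ..., n_f the factor 1 / (p;p)_(n_i) of the multisum occurs here as
   1 / (p;p)_(N_i - N_(i+1)). *)
Fixpoint bailey_weight (beta : nat -> F) (L : nat) (s : seq nat) : F :=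
  if s is x :: t then
    p ^ ((sumn s)%:Z ^+ 2) * rqpoch p (L%:Z - (sumn s)%:Z)
      * bailey_weight beta (sumn s) t
  else beta L.

Lemma bailey_weight_sum (I : Type) (r : seq I) (beta : I -> nat -> F) L s :
  bailey_weight (fun x => \sum_(i <- r) beta i x) L s
  = \sum_(i <- r) bailey_weight (beta i) L s.
Proof. by elim: s L => //= x t IH L; rewrite IH big_distrr. Qed.

Lemma bailey_weight_lt beta L s : (L < sumn s)%N -> bailey_weight beta L s = 0.
Proof.
case: s => // x t Ls.
by rewrite /bailey_weight rqpoch_lt0 ?(mulr0, mul0r) //; lia.
Qed.

(** The weight depends on n_1 only through r = N_1, so r replaces n_1 as summation variable. Values
    of r below the sum of the other entries or above L contribute 0, and [L < B] keeps every r <= L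
    in range. *)
Lemma bailey_weight_sumS beta B f L : (L < B)%N ->
  \sum_(v : f.+1.-tuple 'I_B) bailey_weight beta L [seq val x | x <- v]
  = \sum_(0 <= r < L.+1) p ^ (r%:Z ^+ 2) * rqpoch p (L%:Z - r%:Z)
      * \sum_(v : f.-tuple 'I_B) bailey_weight beta r [seq val x | x <- v].
Proof.
move=> LB; rewrite big_tupleS exchange_big /=.
under [RHS]eq_bigr do rewrite big_distrr /=.
rewrite [RHS]exchange_big; apply: eq_bigr => v _ /=.
set t := [seq val x | x <- v]; set S := sumn t.
pose H r := p ^ (r%:Z ^+ 2) * rqpoch p (L%:Z - r%:Z) * bailey_weight beta r t.
have H0 r : (r < S)%N || (L < r)%N -> H r = 0.
  case/orP=> hr; first by rewrite /H bailey_weight_lt ?mulr0.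
  by rewrite /H rqpoch_lt0 ?(mulr0, mul0r) //; lia.
rewrite -(big_mkord xpredT (fun i => H (i + S)%N)).
transitivity (\sum_(0 <= r < B + S) H r).
  rewrite [RHS](big_cat_nat (n := S)) ?leq_addl //= -{3}[S]add0n big_addn addnK.
  rewrite [X in _ = X + _]big_nat [X in _ = X + _]big1 ?add0r //.
  by move=> r /andP[_ rS]; rewrite H0 // rS.
rewrite (big_cat_nat (n := L.+1)) ?ltn_addr //=.
rewrite [X in _ + X]big_nat [X in _ + X]big1 ?addr0 //.
by move=> r /andP[Lr _]; rewrite H0 // Lr orbT.
Qed.

(** The hypothesis is a Bailey pair relative to 1, and each level of the chain multiplies [alpha i]
    by [p ^ (j i ^+ 2)]. The pair is required only below B, so that one finite index list can serve
    all x. *)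
Lemma bailey_chain (I : Type) (r : seq I) (j : I -> int) (alpha : I -> F)
    (beta : nat -> F) (B : nat) :
  (forall x, (x < B)%N -> beta x =
     \sum_(i <- r) alpha i * (rqpoch p (x%:Z - j i) * rqpoch p (x%:Z + j i))) ->
  forall f L, (L < B)%N ->
  \sum_(v : f.-tuple 'I_B) bailey_weight beta L [seq val x | x <- v] =
  \sum_(i <- r) alpha i * (p ^ (f%:Z * j i ^+ 2)
     * (rqpoch p (L%:Z - j i) * rqpoch p (L%:Z + j i))).
Proof.
move=> betaE; elim=> [|f IH] L LB.
  rewrite (big_pred1 [tuple]) /=; last by move=> v; rewrite (tuple0 v) /= eqxx.
  by rewrite betaE //; apply: eq_bigr => i _; rewrite mul0r expr0z mul1r.
rewrite bailey_weight_sumS // big_nat.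
under eq_bigr => x /andP[_ xL].
  rewrite IH; last by lia.
  rewrite big_distrr /=; over.
rewrite -big_nat exchange_big /=; apply: eq_bigr => i _.
have -> : p ^ (f.+1%:Z * j i ^+ 2) = p ^ (f%:Z * j i ^+ 2) * p ^ (j i ^+ 2).
  by rewrite -expfzDr //; congr (p ^ _); rewrite intS; ring.
rewrite -[_ * p ^ _ * _]mulrA -(bailey_lemma _ _ p1 p0) !big_distrr.
by apply: eq_bigr => x _ /=; ring.
Qed.

(** Links the recursive weight to the shape of the multisum by peeling off n_1, with N_1 - N_2 =
    n_1. The last entry n_f enters through [beta], so the product stops before it. *)
Lemma bailey_weightE (beta : nat -> F) L (s : seq nat) : (0 < size s)%N ->
  let S i := (\sum_(i <= k < (size s).+1) nth 0%N s k.-1)%N in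
  p ^ (\sum_(1 <= i < (size s).+1) (S i)%:Z ^+ 2) * rqpoch p (L%:Z - (S 1%N)%:Z)
  * (\prod_(1 <= i < size s) rqpoch p (nth 0%N s i.-1)%:Z)
  * beta (nth 0%N s (size s).-1) = bailey_weight beta L s.
Proof.
have S1 u : (\sum_(1 <= k < (size u).+1) nth 0 u k.-1 = sumn u)%N.
  by rewrite sumnE [RHS](big_nth 0%N) big_add1.
elim: s L => // x t IH L _ S; case: t => [|y t] in IH S *.
  rewrite /S !big_nat1 /= [\prod_(_ <= _ < _) _]big_geq //= mulr1 addn0.
  by [].
have Sx : S 1%N = sumn (x :: y :: t) by exact: S1.
have SS i : (0 < i)%N ->
    S i.+1 = (\sum_(i <= k < (size (y :: t)).+1) nth 0 (y :: t) k.-1)%N.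
  move=> i0; rewrite /S big_add1 big_nat [RHS]big_nat; apply: eq_bigr => k.
  by case: k => // /andP[]; rewrite leqNgt i0.
clearbody S; have -> : bailey_weight beta L [:: x, y & t] =
    p ^ ((sumn [:: x, y & t])%:Z ^+ 2) * rqpoch p (L%:Z - (sumn [:: x, y & t])%:Z)
      * bailey_weight beta (sumn [:: x, y & t]) (y :: t) by [].
rewrite -{}IH // S1 Sx.
have -> : \sum_(1 <= i < (size [:: x, y & t]).+1) (S i)%:Z ^+ 2 =
    (sumn [:: x, y & t])%:Z ^+ 2 + \sum_(1 <= i < (size (y :: t)).+1)
      (\sum_(i <= k < (size (y :: t)).+1) nth 0 (y :: t) k.-1)%N%:Z ^+ 2.
  rewrite big_ltn // Sx big_add1; congr (_ + _); rewrite big_nat [RHS]big_nat.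
  by apply: eq_bigr => i /andP[i0 _]; rewrite SS.
have -> : \prod_(1 <= i < size [:: x, y & t]) rqpoch p (nth 0%N [:: x, y & t] i.-1)%:Z
    = rqpoch p x%:Z * \prod_(1 <= i < size (y :: t)) rqpoch p (nth 0%N (y :: t) i.-1)%:Z.
  rewrite big_ltn // big_add1; congr (_ * _); rewrite big_nat [RHS]big_nat.
  by apply: eq_bigr => i /andP[i0 _]; case: i i0.
have -> : (sumn [:: x, y & t])%:Z - (sumn (y :: t))%:Z = x%:Z by rewrite /=; lia.
rewrite expfzDr //=; ring.
Qed.

End BaileyChain.

Arguments bailey_weight {F} p beta L s.

(** * Support of the summand and assembly of the identity *)

Lemma summand_support (F : fieldType) (q : F) L f m n (v : f.-tuple nat) : (0 < f)%N ->
  summand q L m n v != 0 -> [/\ (m <= L)%N, (n <= L)%N & all (leq^~ L) v].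
Proof.
move=> f0; rewrite /summand !mulf_eq0 !negb_or.
(* The index L - N_1 bounds every n_i by L; the index n_f - 2n - m then bounds m and n. *)
case/andP=> /andP[/andP[/andP[_ /rqpoch_neq0 NL] /rqpoch_neq0 mn] _] _.
have vL i : (0 < i <= f)%N -> (part v i <= L)%N.
  by move=> /part_le_tailsum => /(_ v) iN; apply: leq_trans iN _; lia.
have := vL f; rewrite f0 leqnn => /(_ isT) nfL; split; try lia.
apply/(all_nthP 0%N) => i; rewrite size_tuple => iv.
by apply: (vL i.+1); rewrite iv.
Qed.

Section Assembly.
Variables (F : fieldType) (q : F).
Hypothesis q0 : q != 0.
Hypothesis q1 : forall k : nat, (0 < k)%N -> q ^+ k != 1.

Let p := q ^+ 3.
Let p0 : p != 0. Proof. exact: expf_neq0. Qed.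
Let p1 k : (0 < k)%N -> p ^+ k != 1.
Proof. by move=> k0; rewrite /p -exprM q1 // muln_gt0. Qed.

(** The initial [beta] of the Bailey chain for fixed (m, n), with M in the place of n_f. *)
Definition seed (mn : nat * nat) (M : nat) : F :=
  q ^ (2 * mn.1%:Z ^+ 2 + 6 * mn.1%:Z * mn.2%:Z + 6 * mn.2%:Z ^+ 2
       - 2 * mn.1%:Z - 3 * mn.2%:Z)
  * (rqpoch q mn.1%:Z * rqpoch p mn.2%:Z
     * rqpoch p (M%:Z - 2 * mn.2%:Z - mn.1%:Z))
  * (qpoch p p M * (1 + p ^+ M) * rqpoch p (2 * M)%:Z).

Lemma summandE L f m n (v : f.-tuple nat) : (0 < f)%N ->
  summand q L m n v = qpoch p p (2 * L) * bailey_weight p (seed (m, n)) L v.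
Proof.
move=> f0; rewrite -(bailey_weightE _ _ p0) ?size_tuple //.
rewrite /summand /expo expfzDr // -(expr3z _ q) -/p /seed /part /tailsum /=.
rewrite exprM -/p; ring.
Qed.

Lemma sum_int_window (L M : nat) (G : int -> F) (k : nat) : (M <= L)%N -> (k <= M)%N ->
  (forall x, (x < 0) || (M%:Z < x) -> G x = 0) ->
  \sum_(0 <= i < 2 * L + 3) G (k%:Z + (i%:Z - (L.+1)%:Z))
  = \sum_(0 <= l < M.+1) G l%:Z.
Proof.
move=> ML kM G0; rewrite -(@sum_int_shift _ G M (2 * L + 3) (L.+1 - k)) //.
  by apply: eq_bigr => i _; congr G; lia.
by lia.
Qed.

(** The case f = 0 divided by (p;p)_(2M), in the form of a Bailey pair. The window for j is set by
    L, not M, because [bailey_chain] needs the same indices for all M <= L. *)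
Lemma sum_seed (L M : nat) : (M < L.+1)%N ->
  \sum_(mn : 'I_L.+1 * 'I_L.+1) seed (val mn.1, val mn.2) M =
  \sum_(0 <= i < 2 * L + 3) let j : int := i%:Z - (L.+1)%:Z in
    q ^ (3 * j ^+ 2 - 2 * j) * (1 + q ^ (3 * j))
      * (rqpoch p (M%:Z - j) * rqpoch p (M%:Z + j)).
Proof.
move=> ML.
pose t n m := q ^ (2 * m%:Z ^+ 2 + 6 * m%:Z * n%:Z + 6 * n%:Z ^+ 2
         - 2 * m%:Z - 3 * n%:Z)
       * (rqpoch q m%:Z * rqpoch p n%:Z * rqpoch p (M%:Z - 2 * n%:Z - m%:Z)).
have cut (H : nat -> F) : (forall n, (M < n)%N -> H n = 0) ->
    \sum_(0 <= n < L.+1) H n = \sum_(0 <= n < M.+1) H n.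
  move=> H0; rewrite (big_cat_nat (n := M.+1)) //= [X in _ + X]big_nat.
  by rewrite [X in _ + X]big1 ?addr0 // => n /andP[Mn _]; apply: H0.
have t0 n m : (M < m + 2 * n)%N -> t n m = 0.
  by move=> h; rewrite /t (rqpoch_lt0 _ _ (_ - m%:Z)) ?mulr0 //; lia.
transitivity (qpoch p p M * (1 + p ^+ M) * rqpoch p (2 * M)%:Z
   * \sum_(0 <= n < M.+1) \sum_(0 <= m < M.+1) t n m).
  rewrite -(pair_big xpredT xpredT (fun m n : 'I_L.+1 => seed (val m, val n) M)) /=.
  rewrite exchange_big -(cut (fun n => \sum_(0 <= m < M.+1) t n m)); last first.
    by move=> n Mn; rewrite big1 // => m _; rewrite t0 //; lia.
  rewrite big_mkord big_distrr; apply: eq_bigr => n _ /=.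
  rewrite -(cut (t n)); last by move=> m Mm; rewrite t0 //; lia.
  by rewrite big_mkord big_distrr; apply: eq_bigr => m _ /=; rewrite mulrC.
transitivity (rqpoch p (2 * M)%:Z * \sum_(0 <= i < 2 * L + 3)
    let j : int := i%:Z - (L.+1)%:Z in q ^ (3 * j ^+ 2 - 2 * j)
      * ((1 + p ^ j) * qbin p (M + M) (M%:Z + j))); last first.
  rewrite big_distrr; apply: eq_bigr => i _ /=; set j := i%:Z - _.
  rewrite /qbin (expr3z _ q).
  have -> : (M + M)%N%:Z - (M%:Z + j) = M%:Z - j by lia.
  have -> : (M + M = 2 * M)%N by lia.
  transitivity (qpoch p p (2 * M) * rqpoch p (2 * M)%:Z *
    (q ^ (3 * j ^+ 2 - 2 * j) * (1 + q ^ (3 * j))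
      * (rqpoch p (M%:Z - j) * rqpoch p (M%:Z + j)))); first by ring.
  by rewrite (rqpochK _ _ p1) mul1r.
under [in RHS]eq_bigr => i _ /= do rewrite -(sum_qbin_shift _ _ p1 p0) mulrCA.
rewrite -big_distrr /=.
transitivity (rqpoch p (2 * M)%:Z * ((1 + p ^+ M) * (qpoch p p M *
    \sum_(0 <= n < M.+1) \sum_(0 <= m < M.+1) t n m))); first by ring.
congr (_ * (_ * _)); rewrite -(sum_qbin_qbin _ _ q0 q1).
under [RHS]eq_bigr do rewrite big_distrr /=.
rewrite [RHS]exchange_big !big_nat; apply: eq_bigr => k /andP[_ kM] /=.
(* Substituting l = k + j turns 3j^2 - 2j + 3k(k+j-1) into 3(k^2 - kl + l^2) - k - 2l. *)
rewrite -(@sum_int_window L M (fun x => q ^ (3 * (k%:Z ^+ 2 - k%:Z * x + x ^+ 2) - k%:Z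
   - 2 * x) * (qbin p M k%:Z * qbin p M x)) k) //; last first.
  move=> x /orP[] hx; first by rewrite (qbin_lt0 _ _ _ x) // !mulr0.
  by rewrite (qbin_gt _ _ _ x) // !mulr0.
apply: eq_bigr => i _; set j := i%:Z - _.
rewrite [RHS]mulrA (expr3z _ q) -expfzDr //; congr (q ^ _ * _); ring.
Qed.

Lemma finite_multisum (L f : nat) : (0 < f)%N ->
  \sum_(mn : 'I_L.+1 * 'I_L.+1) \sum_(v : f.-tuple 'I_L.+1)
     summand q L (val mn.1) (val mn.2) [tuple of [seq val x | x <- v]] =
  \sum_(0 <= i < 2 * L + 3) let j : int := i%:Z - (L.+1)%:Z in
     q ^ (3 * (f%:Z + 1) * j ^+ 2 - 2 * j) * (1 + q ^ (3 * j))
     * qbinom p (2 * L%:Z) (L%:Z - j).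
Proof.
move=> f0; rewrite exchange_big.
under eq_bigr => v _.
  under eq_bigr => mn _ do rewrite summandE //.
  rewrite -big_distrr -bailey_weight_sum /=; over.
rewrite -big_distrr /=.
rewrite (bailey_chain _ _ p1 p0 _ _ (fun i : nat => i%:Z - (L.+1)%:Z)
  (fun i : nat => let j : int := i%:Z - (L.+1)%:Z in
    q ^ (3 * j ^+ 2 - 2 * j) * (1 + q ^ (3 * j))) _ _ (sum_seed L)) //.
rewrite big_distrr; apply: eq_bigr => i _ /=; set j := i%:Z - _.
rewrite (expr3z _ q).
(* At j = L + 1 and j = -L - 1 one of L - j, L + j is -1, and both sides are 0. *)
have -> : qbinom p (2 * L%:Z) (L%:Z - j)
  = qpoch p p (2 * L) * (rqpoch p (L%:Z - j) * rqpoch p (L%:Z + j)).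
  rewrite /qbinom; have -> : 2 * L%:Z - (L%:Z - j) = L%:Z + j by ring.
  have -> : absz (2 * L%:Z) = (2 * L)%N by lia.
  case: (L%:Z - j) => a; case: (L%:Z + j) => b //=.
  - by rewrite invfM.
  - by rewrite !mulr0.
  - by rewrite mul0r mulr0.
  - by rewrite mul0r mulr0.
have -> : q ^ (3 * (f%:Z + 1) * j ^+ 2 - 2 * j)
   = q ^ (3 * j ^+ 2 - 2 * j) * q ^ (3 * (f%:Z * j ^+ 2)).
  by rewrite -expfzDr //; congr (q ^ _); ring.
ring.
Qed.

End Assembly.

Theorem theorem19 (F : fieldType) (q : F) (hq0 : q != 0)
    (hq : forall k : nat, (0 < k)%N -> q ^+ k != 1)
    (L f : nat) (hf : (0 < f)%N) :
  \sum_(x \in [set: nat * nat * f.-tuple nat]) summand q L x.1.1 x.1.2 x.2 =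
  \sum_(j \in [set j : int | - L%:Z - 1 <= j <= L%:Z + 1])
     q ^ (3 * (f%:Z + 1) * j ^+ 2 - 2 * j) * (1 + q ^ (3 * j))
     * qbinom (q ^+ 3) (2 * L%:Z) (L%:Z - j).
Proof.
pose T : finType := ('I_L.+1 * 'I_L.+1 * f.-tuple 'I_L.+1)%type.
pose h (y : T) : nat * nat * f.-tuple nat :=
  (val y.1.1, val y.1.2, [tuple of [seq val z | z <- y.2]]).
have h_inj : injective h.
  move=> [[m n] v] [[m' n'] v'] [] /val_inj -> /val_inj -> /(inj_map val_inj) vv.
  by congr (_, _); apply: val_inj.
pose r := [seq h y | y <- enum T].
(* Off the image of the box of entries at most L the summand vanishes, so the sum over all indices
   is a finite one. *)
rewrite -(@fsbig_widen _ _ _ _ [set` r]) //; last first.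
  case=> [[m n] v] /= [_ Nr]; apply: contrapT => /eqP s0; apply: Nr.
  have [mL nL /allP vL] := summand_support _ _ _ _ _ _ _ hf s0.
  apply/mapP; exists (inord m, inord n, [tuple of [seq inord z | z <- v]]).
    by rewrite mem_enum.
  rewrite /h /= !inordK //; congr (_, _, _); apply: val_inj => /=.
  by rewrite -map_comp map_id_in // => z /vL zL /=; rewrite inordK.
rewrite -fsbig_seq; last by rewrite /r map_inj_uniq ?enum_uniq.
rewrite /= /r big_map big_enum /=.
(* The 2L + 3 integers from -L - 1 to L + 1 are numbered from 0. *)
pose j (i : nat) : int := i%:Z - L.+1%:Z.
rewrite (_ : [set x : int | - L%:Z - 1 <= x <= L%:Z + 1]
  = [set` [seq j i | i <- index_iota 0 (2 * L + 3)]]); last first.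
  apply/seteqP; split=> x /=.
    move=> Lx; apply/mapP; exists (absz (x + L.+1%:Z)); last by rewrite /j; lia.
    by rewrite mem_index_iota; lia.
  by case/mapP=> i; rewrite mem_index_iota /j => iL ->; lia.
rewrite -fsbig_seq; last by rewrite map_inj_uniq ?iota_uniq // => a b; rewrite /j; lia.
rewrite big_map -(finite_multisum _ _ hq0 hq) // pair_big /=.
by apply: eq_bigr => y _.
Qed.
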